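(* Let $N>100$ be an integer, and let $m=(N+1)/2$ if $N$ is odd and $m=N/2$ if $N$ is even. Let $x_1>x_2>\dots>x_N$ be the unique strictly decreasing solution with zero median (equivalently, with $x_1+\dots+x_N=0$) of the recursion $$x_{n+1}=x_n-\frac{1}{x_1+\cdots+x_n},\qquad 1\le n\le N-1,$$ and let $S_n=\sum_{i=1}^n x_i$ for $1\le n\le N$. Then: (a) $0\le x_m\le \dfrac1m$. (b) For $1\le n\le m-1$, $$x_n\le \sqrt{2(1+\log(m/n))}$$ and $$\left(\frac{n(n+1)}{2}\right)^{1/2}\le S_n\le \frac{3n}{2}\sqrt{2(1+\log(m/n))}.$$ (c) For $1\le n\le \lfloor m/e^3\rfloor$, $$x_n\ge \frac13\sqrt{2(1+\log(m/n))}\quad\text{and}\quad S_n\ge \frac n3\sqrt{2(1+\log(m/n))}.$$ (d) For $1\le i<j\le \lfloor m/e^3\rfloor$, $$x_i^2-x_j^2\ge \frac{4\log(j/i)}{9}.$$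
   Context: Zero median means $x_m=0$ if $N$ is odd and $x_m=-x_{m+1}$ if $N$ is even. It is known (McKeague and Levin) that the recursion has exactly one strictly decreasing solution with $x_1+\dots+x_N=0$, that this solution has zero median, that every zero-median solution has zero mean, and that it satisfies $x_1^2+\dots+x_N^2=N-1$ and $x_n=-x_{N+1-n}$ for $1\le n\le N$. The symbol $\log$ denotes the natural logarithm and $\lfloor x\rfloor$ the greatest integer at most $x$. *)

(* Defs.v *)
From mathcomp Require Export all_boot all_order all_algebra.
From mathcomp Require Export reals sequences exp.
Export Order.TTheory GRing.Theory Num.Theory.

Set Implicit Arguments.
Unset Strict Implicit.
Unset Printing Implicit Defensive.

Local Open Scope ring_scope.

(* A finite sequence x_1, ..., x_N is encoded as x : nat -> R; only the values
   at the indices 1, ..., N are ever constrained or used. *)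

Definition partial_sum (R : realType) (x : nat -> R) (n : nat) : R :=
  \sum_(1 <= i < n.+1) x i.

Definition median_index (N : nat) : nat :=
  if odd N then (N.+1 %/ 2)%N else (N %/ 2)%N.

(* Division is total with 1 / 0 = 0, so the nonvanishing of the denominators
   has to be required for the right-hand side to be meaningful. *)
Definition recursion_solution (R : realType) (N : nat) (x : nat -> R) : Prop :=
  forall n : nat, (1 <= n <= N.-1)%N ->
    partial_sum x n != 0 /\ x n.+1 = x n - 1 / partial_sum x n.

Definition strictly_decreasing (R : realType) (N : nat) (x : nat -> R) : Prop :=
  forall i j : nat, (1 <= i)%N -> (i < j)%N -> (j <= N)%N -> x j < x i.

Definition zero_median (R : realType) (N : nat) (x : nat -> R) : Prop :=
  let m := median_index N in
  if odd N then x m = 0 else x m = - x m.+1.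

(* Main.v *)
(* Up to the median m the x_k are nonnegative, so S_k increases and every
   decrement x_k - x_{k+1} = 1 / S_k with k <= n is at least 1 / S_n; summing
   twice gives S_n^2 >= n (n+1) / 2 + n x_{n+1} S_n, and for N even, where
   x_{m+1} S_m = - 1/2, this bounds x_m.

   Everything else comes from x_k^2 - x_{k+1}^2 = (x_k + x_{k+1}) / S_k.
   Since S_k >= k x_k, the right side is at most 2 / k, whence the upper bound
   on x_n, and by summation on S_n.  Since it is at least
   2 ln (S_{k+1} / S_k), one has x_n^2 >= 2 ln (S_m / S_n), where S_m is of
   order m and S_n is bounded above: this is (c).  Inserting (c) and the upper
   bound on S_k back into the identity gives (d), the loss from x_{k+1} < x_k
   being absorbed by the second-order term of ln (1 + 1/k). *)

Require Import Defs.
From mathcomp Require Import ring lra zify.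

Set Implicit Arguments.
Unset Strict Implicit.
Unset Printing Implicit Defensive.

Local Open Scope ring_scope.

(** * Logarithm estimates *)

Lemma ln_le_subr1 (R : realType) (y : R) : 0 < y -> ln y <= y - 1.
Proof.
move=> y0; have := @le_ln1Dx R (y - 1).
by rewrite addrCA subrr addr0; apply; lra.
Qed.

Lemma lnS_sub_le (R : realType) (k : nat) : (0 < k)%N ->
  ln k.+1%:R - ln k%:R <= (k%:R)^-1 :> R.
Proof.
move=> kn; have k0 : 0 < k%:R :> R by rewrite ltr0n.
rewrite -ln_div ?posrE ?ltr0n //.
apply: le_trans (ln_le_subr1 _) _; first by rewrite divr_gt0 ?ltr0n.
rewrite -natr1 mulrDl divff ?gt_eqF //; lra.
Qed.

Lemma lnS_sub_ge (R : realType) (k : nat) : (0 < k)%N ->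
  (k.+1%:R)^-1 <= ln k.+1%:R - ln k%:R :> R.
Proof.
move=> kn; have k0 : 0 < k%:R :> R by rewrite ltr0n.
rewrite -opprB lerNr -ln_div ?posrE ?ltr0n //.
have k1 : 0 < k.+1%:R :> R by rewrite ltr0n.
apply: le_trans (ln_le_subr1 _) _; first by rewrite divr_gt0.
have -> : k%:R = k.+1%:R - 1 :> R by rewrite -natr1; lra.
by rewrite mulrBl divff ?gt_eqF // mul1r addrAC subrr add0r.
Qed.

(* Splitting 1 + t = (1 + t/2) * (1 + (t/2) / (1 + t/2)) gains a second-order
   term over ln (1 + t) <= t. *)
Lemma lnS_sub_le_quadratic (R : realType) (k : nat) : (0 < k)%N ->
  ln k.+1%:R - ln k%:R <= (k%:R)^-1 - (k%:R)^-1 ^+ 2 / 8 :> R.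
Proof.
move=> k0; have kR : 0 < k%:R :> R by rewrite ltr0n.
set t : R := (k%:R)^-1.
have t0 : 0 < t by rewrite invr_gt0.
have t1 : t <= 1 by rewrite invf_le1 // ler1n.
set u := 1 + t / 2.
have u0 : 0 < u by rewrite /u; lra.
have -> : ln k.+1%:R - ln k%:R = ln u + ln ((1 + t) / u) :> R.
  rewrite -ln_div ?posrE ?ltr0n // -lnM ?posrE ?divr_gt0 //; last lra.
  congr ln; rewrite [RHS]mulrC divfK ?gt_eqF // -natr1 mulrDl divff ?gt_eqF //.
  by rewrite mul1r.
have h1 := ln_le_subr1 u0.
have h2 : ln ((1 + t) / u) <= (1 + t) / u - 1.
  by apply: ln_le_subr1; rewrite divr_gt0 //; lra.
suff h3 : (1 + t) / u - 1 <= t / 2 - t ^+ 2 / 8 by rewrite /u in h1 *; lra.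
rewrite lerBlDr ler_pdivrMr // /u; nra.
Qed.

(* The inequality n^n <= n! * e^n. *)
Lemma sum_ln_sub_le (R : realType) (n : nat) : (0 < n)%N ->
  \sum_(1 <= i < n.+1) (ln n%:R - ln i%:R) <= n%:R :> R.
Proof.
case: n => // n _; elim: n => [|n IH]; first by rewrite big_nat1 subrr ler01.
rewrite big_nat_recr //= subrr addr0.
(* Replacing ln (n+1) by ln (n+2) adds the same increment, at most 1/(n+1), to each of the n+1 old
   terms, hence at most 1 in total. *)
have -> : \sum_(1 <= i < n.+2) (ln n.+2%:R - ln i%:R) =
    \sum_(1 <= i < n.+2) (ln n.+1%:R - ln i%:R) +
    n.+1%:R * (ln n.+2%:R - ln n.+1%:R) :> R.
  have -> : n.+1%:R * (ln n.+2%:R - ln n.+1%:R) =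
      \sum_(1 <= i < n.+2) (ln n.+2%:R - ln n.+1%:R) :> R.
    by rewrite sumr_const_nat subSS subn0 mulr_natl.
  by rewrite -big_split /=; apply: eq_bigr => i _; ring.
rewrite -[leRHS]natr1; apply: lerD IH _.
rewrite mulrC -ler_pdivlMr ?ltr0n // mul1r; exact: lnS_sub_le.
Qed.

(** * Partial sums and the recursion up to the median *)

Lemma partial_sumS (R : realType) (x : nat -> R) (n : nat) :
  partial_sum x n.+1 = partial_sum x n + x n.+1.
Proof. by rewrite /partial_sum big_nat_recr. Qed.

(** Going back from x_{n+1}, the terms dominate an arithmetic progression of step c. Applied with c
    = 0 and with c = 1 / S_n. *)
Lemma partial_sum_ge_arith (R : realType) (x : nat -> R) (c : R) (n : nat) :
  (forall i, (1 <= i <= n)%N -> x i.+1 + c <= x i) ->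
  n%:R * x n.+1 + c * (n%:R * (n%:R + 1) / 2) <= partial_sum x n.
Proof.
elim: n => [|n IH] h; first by rewrite /partial_sum big_geq // !mul0r mulr0 addr0.
have {}IH : n%:R * x n.+1 + c * (n%:R * (n%:R + 1) / 2) <= partial_sum x n.
  by apply: IH => i hi; apply: h; lia.
have hn : x n.+2 + c <= x n.+1 by apply: h; lia.
rewrite partial_sumS.
have n0 : 0 <= n%:R :> R by rewrite ler0n.
rewrite -natr1; nra.
Qed.

(** Isolates what the estimates need, so that the parity of N no longer matters. At k = m the
    recursion still reaches x_{m+1}, whose sign is left open. *)
Definition descent (R : realType) (m : nat) (x : nat -> R) : Prop :=
  forall k, (1 <= k <= m)%N ->
    [/\ 0 <= x k, 0 < partial_sum x k & x k.+1 = x k - (partial_sum x k)^-1].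

Lemma descent_partial_sum_le (R : realType) (m : nat) (x : nat -> R) (i j : nat) :
  descent m x -> (i <= j <= m)%N -> partial_sum x i <= partial_sum x j.
Proof.
move=> h; elim: j => [|j IH]; first by move=> hi; have -> : i = 0%N by lia.
move=> /andP[]; rewrite leq_eqVlt => /orP[/eqP -> //|ij] jm.
rewrite partial_sumS; have [x0 _ _] : _ := h j.+1 ltac:(lia).
by apply: le_trans (IH _) _; [lia | rewrite lerDl].
Qed.

Lemma descent_partial_sum_ge_mul (R : realType) (m : nat) (x : nat -> R) (n : nat) :
  descent m x -> (1 <= n <= m)%N -> n%:R * x n <= partial_sum x n.
Proof.
case: n => // n h hn; rewrite partial_sumS -natr1 mulrDl mul1r lerD2r.
have := @partial_sum_ge_arith R x 0 n; rewrite mul0r addr0; apply=> i hi.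
have [_ s0 ->] := h i ltac:(lia).
by rewrite addr0 gerBl invr_ge0 ltW.
Qed.

(* The partial sums grow, so every decrement up to n is at least 1 / S_n. *)
Lemma descent_sqr_partial_sum_ge (R : realType) (m : nat) (x : nat -> R) (n : nat) :
  descent m x -> (1 <= n <= m)%N ->
  n%:R * x n.+1 * partial_sum x n + n%:R * (n%:R + 1) / 2 <= partial_sum x n ^+ 2.
Proof.
move=> h hn; have [_ s0 _] := h n hn.
have := @partial_sum_ge_arith R x (partial_sum x n)^-1 n.
set S := partial_sum x n in s0 * => hS.
have {}hS : n%:R * x n.+1 + S^-1 * (n%:R * (n%:R + 1) / 2) <= S.
  apply: hS => i hi; have [_ si ->] := h i ltac:(lia).
  have : S^-1 <= (partial_sum x i)^-1.
    by rewrite lef_pV2 ?posrE //; apply: (descent_partial_sum_le h); lia.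
  lra.
rewrite expr2; have := ler_wpM2r (ltW s0) hS.
by rewrite mulrDl -(mulrA S^-1) (mulrC S^-1) -!mulrA mulfV ?gt_eqF // mulr1 !mulrA.
Qed.

(** * Upper bounds from differences of squares *)

Lemma descent_sqr_sub (R : realType) (m : nat) (x : nat -> R) (k : nat) :
  descent m x -> (1 <= k <= m)%N ->
  x k ^+ 2 - x k.+1 ^+ 2 = (x k + x k.+1) / partial_sum x k.
Proof. by move=> h /h [_ _ ->]; ring. Qed.

(** Induction downwards from m. One step costs at most 2/n, and the bound itself grows by 2/n -
    2/(n+1) + 2 ln ((n+1)/n), which is at least 2/n since ln ((n+1)/n) >= 1/(n+1). *)
Lemma descent_sqr_le (R : realType) (m : nat) (x : nat -> R) (n : nat) :
  descent m x -> x m <= 1 / m%:R -> (1 <= n <= m)%N ->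
  x n ^+ 2 <= 2 / n%:R + 2 * (ln m%:R - ln n%:R).
Proof.
move=> h xm /andP[n1 nm]; move: h xm; rewrite -(subnKC nm).
move: (m - n)%N => d {nm}; elim: d n n1 => [|d IH] n n1.
  rewrite addn0 subrr mulr0 addr0 => h.
  have [x0 _ _] := h n ltac:(lia).
  have n0 : 0 < n%:R :> R by rewrite ltr0n.
  have : (n%:R)^-1 <= 1 :> R by rewrite invf_le1 // ler1n.
  have : 0 < (n%:R)^-1 :> R by rewrite invr_gt0.
  rewrite mul1r; nra.
rewrite addnS -addSn => h xm; have {IH} := IH n.+1 isT h xm.
have [x0 s0 e] := h n ltac:(lia).
have [x1 _ _] := h n.+1 ltac:(lia).
have := descent_sqr_sub h (k := n) ltac:(lia).
have hs := descent_partial_sum_ge_mul h (n := n) ltac:(lia).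
have n0 : 0 < n%:R :> R by rewrite ltr0n.
have : (x n + x n.+1) / partial_sum x n <= 2 / n%:R.
  rewrite ler_pdivrMr // mulrAC ler_pdivlMr //.
  have : x n.+1 <= x n by rewrite e gerBl invr_ge0 ltW.
  nra.
have := lnS_sub_ge R n1.
set z := (_^-1); set z1 := (_^-1); lra.
Qed.

Definition log_profile (R : realType) (m n : nat) : R :=
  Num.sqrt (2 * (1 + ln (m%:R / n%:R))).

Lemma ln_div_nat (R : realType) (m n : nat) : (1 <= n <= m)%N ->
  ln (m%:R / n%:R) = ln m%:R - ln n%:R :> R.
Proof. by move=> hn; rewrite ln_div ?posrE ?ltr0n //; lia. Qed.

Lemma ln_nat_le (R : realType) (m n : nat) : (1 <= n <= m)%N ->
  ln n%:R <= ln m%:R :> R.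
Proof. by move=> hn; rewrite ler_ln ?posrE ?ltr0n ?ler_nat //; lia. Qed.

Lemma sqr_log_profile (R : realType) (m n : nat) : (1 <= n <= m)%N ->
  log_profile R m n ^+ 2 = 2 * (1 + (ln m%:R - ln n%:R)).
Proof.
move=> hn; rewrite /log_profile ln_div_nat // sqr_sqrtr //.
have := ln_nat_le R hn; lra.
Qed.

Lemma log_profile_gt0 (R : realType) (m n : nat) : (1 <= n <= m)%N ->
  0 < log_profile R m n.
Proof.
move=> hn; rewrite sqrtr_gt0 ln_div_nat //; have := ln_nat_le R hn; lra.
Qed.

Lemma descent_le_log_profile (R : realType) (m : nat) (x : nat -> R) (n : nat) :
  descent m x -> x m <= 1 / m%:R -> (1 <= n <= m)%N -> x n <= log_profile R m n.
Proof.
move=> h xm hn; have [x0 _ _] := h n hn.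
rewrite -(@ler_pXn2r _ 2) ?nnegrE ?(ltW (log_profile_gt0 _ _)) //.
rewrite sqr_log_profile //; apply: le_trans (descent_sqr_le h xm hn) _.
have : (n%:R)^-1 <= 1 :> R by rewrite invf_le1 ?ler1n ?ltr0n //; lia.
lra.
Qed.

(* With s the profile at n,
   x_i <= sqrt (s^2 + 2 ln (n/i)) <= s + ln (n/i) / s. *)
Lemma descent_partial_sum_le_log_profile (R : realType) (m : nat) (x : nat -> R) (n : nat) :
  descent m x -> x m <= 1 / m%:R -> (1 <= n <= m)%N ->
  partial_sum x n <= 3 * n%:R / 2 * log_profile R m n.
Proof.
move=> h xm hn; have := sqr_log_profile R hn; have := log_profile_gt0 R hn.
set s := log_profile R m n => s0 s2.
have n0 : 0 < n%:R :> R by rewrite ltr0n; lia.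
have xi i : (1 <= i <= n)%N -> x i <= s + s^-1 * (ln n%:R - ln i%:R).
  move=> hi; have him : (1 <= i <= m)%N by lia.
  apply: le_trans (descent_le_log_profile h xm him) _.
  have d0 : 0 <= ln n%:R - ln i%:R :> R by rewrite subr_ge0 ln_nat_le.
  have sd : 0 <= s^-1 * (ln n%:R - ln i%:R) by rewrite mulr_ge0 // invr_ge0 ltW.
  rewrite -(@ler_pXn2r _ 2) ?nnegrE ?(ltW (log_profile_gt0 _ _)) //; last lra.
  have e : s * (s^-1 * (ln n%:R - ln i%:R)) = ln n%:R - ln i%:R.
    by rewrite mulrA mulfV ?gt_eqF // mul1r.
  rewrite sqr_log_profile //; move: sd e; set w := s^-1 * _ => sd e; nra.
have : partial_sum x n <= n%:R * s + s^-1 * n%:R.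
  apply: (@le_trans _ _ (\sum_(1 <= i < n.+1) (s + s^-1 * (ln n%:R - ln i%:R)))).
    by apply: ler_sum_nat => i hi; apply: xi; lia.
  rewrite big_split /= sumr_const_nat subSS subn0 -[s *+ n]mulr_natl lerD2l -mulr_sumr.
  by rewrite ler_wpM2l ?invr_ge0 ?(ltW s0) // sum_ln_sub_le //; lia.
(* Since s^2 >= 2, the correction n/s is at most n s / 2; hence the factor 3/2. *)
have : s^-1 <= s / 2.
  rewrite -[s^-1]mul1r ler_pdivrMr //.
  have := ln_nat_le R hn; nra.
nra.
Qed.

(** * Lower bounds from the energy *)

(* x_n^2 + 2 ln S_n is nonincreasing: the discrete form of the energy of
   S'' = - 1 / S. *)
Lemma descent_energy (R : realType) (m : nat) (x : nat -> R) (n : nat) :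
  descent m x -> (1 <= n <= m)%N ->
  2 * (ln (partial_sum x m) - ln (partial_sum x n)) <= x n ^+ 2.
Proof.
move=> h /andP[n1 nm]; move: h; rewrite -(subnKC nm).
move: (m - n)%N => d {nm}; elim: d n n1 => [|d IH] n n1; first by move=> _; rewrite addn0 subrr mulr0 sqr_ge0.
rewrite addnS -addSn => h; have {IH} := IH n.+1 isT h.
have [x0 s0 e] := h n ltac:(lia).
have [x1 s1 _] := h n.+1 ltac:(lia).
have e2 : _ := descent_sqr_sub h (k := n) ltac:(lia).
have : ln (partial_sum x n.+1) - ln (partial_sum x n) <= x n.+1 / partial_sum x n.
  rewrite -ln_div ?posrE //; apply: le_trans (ln_le_subr1 _) _.
    by rewrite divr_gt0.
  by rewrite partial_sumS mulrDl divff ?gt_eqF //; lra.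
have : 2 * (x n.+1 / partial_sum x n) <= (x n + x n.+1) / partial_sum x n.
  have si : 0 < (partial_sum x n)^-1 by rewrite invr_gt0.
  rewrite e; nra.
lra.
Qed.

Lemma descent_partial_sum_ge_two_thirds (R : realType) (m : nat) (x : nat -> R) :
  descent m x -> (50 < m)%N -> 2 / 3 * m%:R <= partial_sum x m.
Proof.
case: m => // m h m50; have [x0 s0 _] := h m ltac:(lia).
have [x1 s1 _] := h m.+1 ltac:(lia).
have := descent_sqr_partial_sum_ge h (n := m) ltac:(lia).
rewrite partial_sumS -[m.+1%:R]natr1.
have : 50 <= m%:R :> R by rewrite (ler_nat _ 50).
move=> mR hS.
have hS2 : m%:R * (m%:R + 1) / 2 <= partial_sum x m ^+ 2.
  have : 0 <= m%:R * x m.+1 * partial_sum x m by rewrite !mulr_ge0 // ltW.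
  lra.
suff : 2 / 3 * (m%:R + 1) <= partial_sum x m by lra.
rewrite -(@ler_pXn2r _ 2) ?nnegrE ?(ltW s0) //; last lra.
apply: le_trans hS2; nra.
Qed.

(** Here 81/2 = 8 (9/4)^2 is the constant met in [descent_ge_log_profile]. As e^(1/10) >= 11/10, e^4
    >= (11/10)^40 > 45. *)
Lemma ln_81_2_le4 (R : realType) : ln (81 / 2) <= 4 :> R.
Proof.
rewrite -ler_expR lnK ?posrE; last lra.
have -> : 4 = 40%:R * (1 / 10) :> R by lra.
rewrite expRM_natl.
have e : 11 / 10 <= expR (1 / 10) :> R.
  by apply: le_trans (expR_ge1Dx _); lra.
apply: (@le_trans _ _ ((11 / 10) ^+ 40)); first by lra.
by rewrite ler_pXn2r ?nnegrE ?expR_ge0 //; lra.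
Qed.

Lemma descent_ge_log_profile (R : realType) (m : nat) (x : nat -> R) (n : nat) :
  descent m x -> x m <= 1 / m%:R -> (50 < m)%N -> (1 <= n <= m)%N ->
  3 <= ln m%:R - ln n%:R :> R ->
  1 / 3 * log_profile R m n <= x n.
Proof.
move=> h xm m50 hn h3; have [x0 s0 _] := h n hn.
have L2 := sqr_log_profile R hn; have L0 := log_profile_gt0 R hn.
have [_ sm _] := h m ltac:(lia).
have m0 : 0 < m%:R :> R by rewrite ltr0n; lia.
have n0 : 0 < n%:R :> R by rewrite ltr0n; lia.
rewrite -(@ler_pXn2r _ 2) ?nnegrE //; last lra.
apply: le_trans (descent_energy h hn).
have h1 : ln (2 / 3 * m%:R) <= ln (partial_sum x m).
  by rewrite ler_ln ?posrE ?mulr_gt0 ?descent_partial_sum_ge_two_thirds //; lra.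
have h2 : ln (partial_sum x n) <= ln (3 * n%:R / 2 * log_profile R m n).
  rewrite ler_ln ?posrE ?mulr_gt0 ?descent_partial_sum_le_log_profile //; lra.
set s := log_profile R m n in L2 L0 h2 *.
(* The factor 9/4 is (3/2) / (2/3), from the bounds on S_n and S_m. The logarithm of s^2 is replaced
   by its tangent at 8, the least value of s^2 when ln (m/n) >= 3; it remains that s^2 - 2 - (s^2/8
   + 3) >= s^2/9. *)
have h4 : 2 * ln (9 / 4 * s) <= ln (81 / 2) + (s ^+ 2 / 8 - 1).
  have -> : 2 * ln (9 / 4 * s) = ln (81 / 2) + ln (s ^+ 2 / 8).
    have q0 : 0 < s ^+ 2 / 8 by rewrite divr_gt0 ?exprn_gt0 //; lra.
    rewrite -lnM ?posrE //; last lra.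
    rewrite mulr_natl -lnXn; last by rewrite mulr_gt0 //; lra.
    by congr ln; field.
  by rewrite lerD2l ln_le_subr1 // divr_gt0 ?exprn_gt0 //; lra.
have h5 := ln_81_2_le4 R.
have e1 : ln (2 / 3 * m%:R) = ln m%:R + ln (2 / 3) :> R.
  by rewrite lnM ?posrE //; [ring | lra].
have e2 : ln (3 * n%:R / 2 * s) = ln n%:R + ln (2 / 3) + ln (9 / 4 * s).
  rewrite -!lnM ?posrE ?mulr_gt0 //; try lra.
  by congr ln; field.
rewrite exprMn; lra.
Qed.

(** * Gaps between squares *)

Lemma descent_sqr_sub_ge (R : realType) (m : nat) (x : nat -> R) (k : nat) :
  descent m x -> x m <= 1 / m%:R -> (50 < m)%N -> (1 <= k < m)%N ->
  3 <= ln m%:R - ln k.+1%:R :> R ->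
  4 / 9 * (ln k.+1%:R - ln k%:R) <= x k ^+ 2 - x k.+1 ^+ 2.
Proof.
move=> h xm m50 hk h3.
have hk0 : (1 <= k <= m)%N by lia.
have hk1 : (1 <= k.+1 <= m)%N by lia.
have k0 : (0 < k)%N by lia.
have kR : 0 < k%:R :> R by rewrite ltr0n.
have l1 := lnS_sub_le R k0.
have l2 := lnS_sub_le_quadratic R k0.
have l3 : ln k%:R <= ln k.+1%:R :> R by apply: ln_nat_le; lia.
have [x0 s0 _] := h k hk0.
have a0 := log_profile_gt0 R hk0; have a1 := log_profile_gt0 R hk1.
have q0 := sqr_log_profile R hk0; have q1 := sqr_log_profile R hk1.
have h3' : 3 <= ln m%:R - ln k%:R :> R by lra.
have c0 := descent_ge_log_profile h xm m50 hk0 h3'.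
have c1 := descent_ge_log_profile h xm m50 hk1 h3.
have d0 := descent_partial_sum_le_log_profile h xm hk0.
rewrite (descent_sqr_sub h hk0).
set t : R := (k%:R)^-1 in l1 l2.
have t0 : 0 < t by rewrite invr_gt0.
have t1 : t <= 1 by rewrite invf_le1 // ler1n.
have tk : t * k%:R = 1 by rewrite mulVf ?gt_eqF.
set s := log_profile R m k in a0 q0 c0 d0.
set s' := log_profile R m k.+1 in a1 q1 c1.
(* One step lowers the squared profile by at most 2 t, which is at most s^2 t / 4 because s^2 >=
   8. *)
have hs : s * (1 - t / 4) <= s'.
  have t4 : 0 <= 1 - t / 4 by lra.
  rewrite -(@ler_pXn2r _ 2) ?nnegrE ?(ltW a1) ?mulr_ge0 ?(ltW a0) //.
  rewrite exprMn.
  have : (1 - t / 4) ^+ 2 <= 1 - t / 4 by nra.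
  have : 8 <= s ^+ 2 by lra.
  nra.
have hx : s / 3 * (2 - t / 4) <= x k + x k.+1 by lra.
(* This is exactly (s/3) (2 - t/4) divided by the upper bound 3 k s / 2 of S_k. *)
apply: (@le_trans _ _ (4 / 9 * (t - t ^+ 2 / 8))); first lra.
rewrite ler_pdivlMr //; apply: le_trans hx.
have p0 : 0 <= 4 / 9 * (t - t ^+ 2 / 8) by nra.
apply: le_trans (ler_wpM2l p0 d0) _.
have -> : 4 / 9 * (t - t ^+ 2 / 8) * (3 * k%:R / 2 * s) =
  (t * k%:R) * (s / 3 * (2 - t / 4)) by field.
by rewrite tk mul1r.
Qed.

Lemma descent_sqr_sub_ge_ln (R : realType) (m : nat) (x : nat -> R) (i j : nat) :
  descent m x -> x m <= 1 / m%:R -> (50 < m)%N -> (1 <= i <= j)%N -> (j <= m)%N ->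
  3 <= ln m%:R - ln j%:R :> R ->
  4 / 9 * (ln j%:R - ln i%:R) <= x i ^+ 2 - x j ^+ 2.
Proof.
move=> h xm m50; elim: j => [|j IH] hij jm h3; first by lia.
have [-> | ij] := eqVneq i j.+1; first by rewrite !subrr mulr0.
have l : ln j%:R <= ln j.+1%:R :> R by apply: ln_nat_le; lia.
have h1 : 4 / 9 * (ln j%:R - ln i%:R) <= x i ^+ 2 - x j ^+ 2.
  by apply: IH; [lia | lia | lra].
have h2 : 4 / 9 * (ln j.+1%:R - ln j%:R) <= x j ^+ 2 - x j.+1 ^+ 2.
  by apply: (descent_sqr_sub_ge h) => //; lia.
lra.
Qed.

(** * From the zero median to [descent], and the threshold m/e^3 *)

Lemma median_index_bounds (N : nat) : (100 < N)%N ->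
  (50 < median_index N < N)%N.
Proof. by rewrite /median_index => hN; case: ifP => oN; lia. Qed.

Lemma zero_median_descent (R : realType) (N : nat) (x : nat -> R) :
  (100 < N)%N -> recursion_solution N x -> strictly_decreasing N x ->
  zero_median N x -> descent (median_index N) x.
Proof.
move=> hN hrec hdec hmed k hk; have hm := median_index_bounds hN.
have [s0 e] := hrec k ltac:(lia).
have d : x k.+1 < x k by apply: hdec; lia.
have xm : 0 <= x (median_index N).
  move: hmed; rewrite /zero_median; case: ifP => _; first by move=> ->.
  have : x (median_index N).+1 < x (median_index N) by apply: hdec; lia.
  lra.
split; last by rewrite e div1r.
  have [-> // | km] := eqVneq k (median_index N).
  by apply: le_trans xm _; apply/ltW/hdec; lia.
(* The recursion only gives S_k nonzero; its sign comes from the strict decrease, the decrement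
   being 1 / S_k. *)
by move: d; rewrite e gtrBl div1r invr_gt0.
Qed.

(** For N even, 2 x_m = x_m - x_{m+1} = 1 / S_m. The quadratic bound then reads S_m^2 >= m^2 / 2, so
    S_m >= m/2. *)
Lemma zero_median_le (R : realType) (N : nat) (x : nat -> R) :
  (100 < N)%N -> recursion_solution N x -> strictly_decreasing N x ->
  zero_median N x -> x (median_index N) <= 1 / (median_index N)%:R.
Proof.
move=> hN hrec hdec hmed; have hm := median_index_bounds hN.
have h := zero_median_descent hN hrec hdec hmed.
have hmm : (1 <= median_index N <= median_index N)%N by lia.
have [x0 s0 e] := h _ hmm.
have := descent_sqr_partial_sum_ge h hmm; move: hmed; rewrite /zero_median.
case: ifP => _; first by move=> -> _; rewrite divr_ge0 ?ler0n.
set m := median_index N in x0 s0 e hm hmm *.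
have m0 : 0 < m%:R :> R by rewrite ltr0n; lia.
move=> hx; set S := partial_sum x m in s0 e *.
have hS : x m.+1 * S = - (1 / 2).
  have : (x m - x m.+1) * S = 1 by rewrite e opprB addrC subrK mulVf ?gt_eqF.
  by rewrite hx; lra.
rewrite -mulrA hS => S2.
have S2m : m%:R / 2 <= S.
  rewrite -(@ler_pXn2r _ 2) ?nnegrE ?(ltW s0) //; last lra.
  by apply: le_trans S2; nra.
rewrite ler_pdivlMr // hx; rewrite hx in x0; nra.
Qed.

(** Up to the threshold m/e^3 the squared profile is at least 8. *)
Lemma ln_sub_ge_of_floor (R : realType) (m n : nat) : (1 <= n)%N -> (0 < m)%N ->
  n%:Z <= Num.floor (m%:R / expR 3 : R) ->
  (n <= m)%N /\ 3 <= ln m%:R - ln n%:R :> R.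
Proof.
move=> n1 m0; rewrite floor_ge_int; change (n%:~R : R) with (n%:R : R).
have nR : 0 < n%:R :> R by rewrite ltr0n.
have mR : 0 < m%:R :> R by rewrite ltr0n.
rewrite ler_pdivlMr ?expR_gt0 // => hn.
have e1 : 1 <= expR 3 :> R by apply: le_trans (expR_ge1Dx _); lra.
split; first by rewrite -(ler_nat R); nra.
have : ln (n%:R * expR 3) <= ln m%:R :> R.
  by rewrite ler_ln ?posrE ?mulr_gt0 ?expR_gt0.
by rewrite lnM ?posrE ?expR_gt0 // expRK; lra.
Qed.

Theorem lemma3p2 (R : realType) (N : nat) (x : nat -> R)
  (hN : (100 < N)%N)
  (hrec : recursion_solution N x)
  (hdec : strictly_decreasing N x)
  (hmed : zero_median N x) :
  let m := median_index N in
  let S := partial_sum x in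
  let L (n : nat) : R := Num.sqrt (2 * (1 + ln (m%:R / n%:R))) in
  let K : int := Num.floor (m%:R / expR 3 : R) in
  [/\ 0 <= x m <= 1 / m%:R,
      forall n : nat, (1 <= n <= m - 1)%N ->
        x n <= L n /\
        Num.sqrt (n%:R * (n%:R + 1) / 2) <= S n <= 3 * n%:R / 2 * L n,
      forall n : nat, (1 <= n)%N -> n%:Z <= K ->
        x n >= 1 / 3 * L n /\ S n >= n%:R / 3 * L n
    & forall i j : nat, (1 <= i)%N -> (i < j)%N -> j%:Z <= K ->
        x i ^+ 2 - x j ^+ 2 >= 4 * ln (j%:R / i%:R) / 9].
Proof.
move=> m S L K.
have /andP[m50 mN] : (50 < m < N)%N := median_index_bounds hN.
have m0 : (0 < m)%N by lia.
have h : descent m x := zero_median_descent hN hrec hdec hmed.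
have xm : x m <= 1 / m%:R := zero_median_le hN hrec hdec hmed.
split.
- by have [x0 _ _] := h m ltac:(lia); rewrite x0.
- move=> n hn; have hnm : (1 <= n <= m)%N by lia.
  split; first exact: descent_le_log_profile.
  rewrite descent_partial_sum_le_log_profile // andbT.
  have [_ s0 _] := h n hnm; have [x1 _ _] := h n.+1 ltac:(lia).
  have n0 : 0 <= n%:R :> R by rewrite ler0n.
  rewrite -[S n]ger0_norm ?(ltW s0) // -sqrtr_sqr ler_wsqrtr //.
  apply: le_trans (descent_sqr_partial_sum_ge h hnm).
  by rewrite lerDr !mulr_ge0 // ltW.
- move=> n n1 nK; have [nm l3] := ln_sub_ge_of_floor n1 m0 nK.
  have hn : (1 <= n <= m)%N by lia.
  have c : 1 / 3 * L n <= x n by exact: descent_ge_log_profile.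
  split=> //; apply: le_trans (descent_partial_sum_ge_mul h hn).
  have := ler_wpM2l (ler0n R n) c; lra.
- move=> i j i1 ij jK.
  have [jm l3] := ln_sub_ge_of_floor (leq_ltn_trans (leq0n i) ij) m0 jK.
  rewrite ln_div_nat; last by lia.
  have : 4 / 9 * (ln j%:R - ln i%:R) <= x i ^+ 2 - x j ^+ 2.
    by apply: (descent_sqr_sub_ge_ln h) => //; lia.
  lra.
Qed.
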